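(* Let $\sigma$ be a mean on $B(\mathcal{H})^+$ with representing function $f$ and associated measure $\mu$. Then the following statements are equivalent: (1) $\sigma$ is strict at the right, i.e. for all $A>0$ and $B>0$, $A\,\sigma\,B=B\implies A=B$; (2) $\sigma$ is not the right-trivial mean $(A,B)\mapsto B$; (3) for all $A\geq 0$, $A\,\sigma\,I=I\implies A=I$; (4) for all $A>0$, $I\,\sigma\,A=A\implies A=I$; (5) for all $A\geq 0$ and $B>0$, $A\,\sigma\,B=B\implies A=B$; (6) for all $A\geq 0$, $I\leq A\,\sigma\,I\implies I\leq A$; (7) for all $A\geq 0$, $A\,\sigma\,I\leq I\implies A\leq I$; (8) for all $A>0$, $A\leq I\,\sigma\,A\implies A\leq I$; (9) for all $A>0$, $I\,\sigma\,A\leq A\implies I\leq A$; (10) for all $A\geq 0$ and $B>0$, $B\leq A\,\sigma\,B\implies B\leq A$; (11) for all $A\geq 0$ and $B>0$, $A\,\sigma\,B\leq B\implies A\leq B$; (12) $f$ is not the identity function $x\mapsto x$; (13) $\mu$ is not the Dirac measure at $1$.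
   Context: $\mathcal{H}$ is a Hilbert space, $B(\mathcal{H})$ is the algebra of bounded linear operators on $\mathcal{H}$, $B(\mathcal{H})^+$ is the set of positive (i.e. positive semidefinite) operators, and $I$ is the identity operator. For Hermitian $A,B$, $A\leq B$ means $B-A\in B(\mathcal{H})^+$; $A\geq 0$ means $A\in B(\mathcal{H})^+$; $A>0$ means that $A$ is strictly positive, i.e. positive and invertible. $\mathbb{R}^+=[0,\infty)$. A connection is a binary operation $\sigma$ on $B(\mathcal{H})^+$ such that for all positive operators $A,B,C,D$: (M1) $A\leq C$, $B\leq D$ imply $A\,\sigma\,B\leq C\,\sigma\,D$; (M2) $C(A\,\sigma\,B)C\leq (CAC)\,\sigma\,(CBC)$; (M3) if $A_n,B_n\in B(\mathcal{H})^+$, $A_n\downarrow A$ and $B_n\downarrow B$, then $A_n\,\sigma\,B_n\downarrow A\,\sigma\,B$, where $A_n\downarrow A$ means that $(A_n)$ is a decreasing sequence converging strongly to $A$. A mean is a connection $\sigma$ with $A\,\sigma\,A=A$ for all $A\geq 0$. A continuous function $f:\mathbb{R}^+\to\mathbb{R}^+$ is operator monotone if $A\leq B\implies f(A)\leq f(B)$ for all positive operators $A,B$ on any Hilbert space. Standing facts assumed about $\mathcal{H}$ (Kubo–Ando correspondence; it holds for example when $\mathcal{H}$ is infinite-dimensional): for every connection $\sigma$ on $B(\mathcal{H})^+$ there is a unique operator monotone function $f:\mathbb{R}^+\to\mathbb{R}^+$, called the representing function of $\sigma$, with $f(x)I=I\,\sigma\,(xI)$ for all $x\geq 0$, and $\sigma\mapsto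 f$ is a bijection from connections onto operator monotone functions $\mathbb{R}^+\to\mathbb{R}^+$; and there is a unique finite (positive) Borel measure $\mu$ on $[0,1]$, called the associated measure of $\sigma$, with $f(x)=\int_{[0,1]}(1\,!_t\,x)\,d\mu(t)$ for all $x\geq 0$, where $1\,!_t\,x=[(1-t)+t x^{-1}]^{-1}$ for $x>0$, and $1\,!_t\,0=\lim_{x\downarrow 0}1\,!_t\,x$ (equal to $0$ for $t\in(0,1]$ and to $1$ for $t=0$). Every finite Borel measure on $[0,1]$ arises in this way. *)

(* Defs.v *)
From HB Require Import structures.
From mathcomp Require Import all_boot all_order all_algebra.
From mathcomp Require Import all_classical all_reals all_analysis.
From mathcomp Require Import complex.

Set Implicit Arguments.
Unset Strict Implicit.
Unset Printing Implicit Defensive.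

Import Order.TTheory GRing.Theory Num.Theory.
Import numFieldNormedType.Exports.

Local Open Scope classical_set_scope.
Local Open Scope complex_scope.
Local Open Scope ring_scope.

(* Complex Hilbert spaces; the inner product is linear in its first argument,
   conjugate-linear in the second, and induces the norm. *)
Record hilbertSpace (R : realType) := HilbertSpace {
  hilbert_carrier :> completeNormedModType R[i];
  hdot : {dot hilbert_carrier for @Num.conj R[i]};
  hdot_norm : forall x, hdot x x = `|x| ^+ 2 }.

(* Elements of B(H): on a normed space, bounded linear = continuous linear. *)
Record boundedOp (R : realType) (H : hilbertSpace R) := BoundedOp {
  boundedOp_fun :> H -> H;
  boundedOp_linear : linear boundedOp_fun;
  boundedOp_continuous : continuous boundedOp_fun }.

Section Operators.
Context {R : realType} {H : hilbertSpace R}.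
Implicit Types A B C S T : boundedOp H.

Lemma boundedOpP A B : (forall x, A x = B x) -> A = B.
Proof.
case: A B => [f fl fc] [g gl gc] /= /funext fg; subst g.
by rewrite (Prop_irrelevance fl gl) (Prop_irrelevance fc gc).
Qed.

Fact scalop_linear (c : R[i]) : linear (fun x : H => c *: x).
Proof. by move=> a x y; rewrite scalerDr !scalerA mulrC. Qed.

Fact scalop_continuous (c : R[i]) : continuous (fun x : H => c *: x).
Proof. exact: scaler_continuous. Qed.

(* the multiple c I of the identity *)
Definition scalop (c : R[i]) : boundedOp H :=
  BoundedOp (scalop_linear c) (@scalop_continuous c).

Definition idop : boundedOp H := scalop 1.

Fact subop_linear A B : linear (fun x => A x - B x).
Proof.
move=> a x y; rewrite !boundedOp_linear opprD scalerBr.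
by rewrite addrACA.
Qed.

Fact subop_continuous A B : continuous (fun x => A x - B x).
Proof.
by move=> x; apply: cvgB; apply: boundedOp_continuous.
Qed.

Definition subop A B : boundedOp H :=
  BoundedOp (subop_linear A B) (@subop_continuous A B).

Fact compop_linear A B : linear (A \o B).
Proof. by move=> a x y; rewrite /= !boundedOp_linear. Qed.

Fact compop_continuous A B : continuous (A \o B).
Proof.
by move=> x; apply: continuous_comp; apply: boundedOp_continuous.
Qed.

Definition compop A B : boundedOp H :=
  BoundedOp (compop_linear A B) (@compop_continuous A B).

Definition invertible_op A : Prop :=
  exists S, compop A S = idop /\ compop S A = idop.

(* 0 <= z in R[i] means that z is real and nonnegative; the space being
   complex, such an A is automatically Hermitian. *)
Definition posop A : Prop := forall x, 0 <= hdot H (A x) x.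

Definition leop A B : Prop := posop (subop B A).

Definition strict_posop A : Prop := posop A /\ invertible_op A.

Definition decreases_to (A_ : nat -> boundedOp H) A : Prop :=
  (forall n, leop (A_ n.+1) (A_ n)) /\
  (forall x, A_ n x @[n --> \oo] --> A x).

(* The real points of the spectrum; a positive operator has no others. *)
Definition real_spectrum A : set R :=
  [set x | ~ invertible_op (subop A (scalop x%:C))].

Definition horner_op (p : {poly R}) A (v : H) : H :=
  \sum_(k < size p) (p`_k)%:C *: iter k A v.

(* T = f(A) in the continuous functional calculus of a positive A: T is a limit,
   in operator norm, of p(A) for polynomials p converging to f uniformly
   on the spectrum of A. *)
Definition functional_calculus (f : R -> R) A T : Prop :=
  forall e : R, 0 < e -> exists p : {poly R},
    (forall x, x \in real_spectrum A -> `|p.[x] - f x| <= e) /\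
    (forall v, `|horner_op p A v - T v| <= e%:C * `|v|).

End Operators.

Arguments idop {R H}.
Arguments scalop {R H} c.

Notation "A '<=op' B" := (leop A B) (at level 70, no associativity).

Section KuboAndo.
Context {R : realType}.

(* Functions on [0, +oo[ are represented by functions on R, of which only the
   restriction to [0, +oo[ matters. *)
Definition operator_monotone (f : R -> R) : Prop :=
  [/\ {within `[0, +oo[, continuous f},
      forall x, 0 <= x -> 0 <= f x &
      forall (K : hilbertSpace R) (A B fA fB : boundedOp K),
        posop A -> posop B ->
        functional_calculus f A fA -> functional_calculus f B fB ->
        A <=op B -> fA <=op fB].

(* Likewise a binary operation on B(H)^+ is represented by a binary operation
   on B(H) which maps positive operators to positive operators; its values at
   other operators are irrelevant. *)
Definition connection (H : hilbertSpace R)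
    (sigma : boundedOp H -> boundedOp H -> boundedOp H) : Prop :=
  [/\ forall A B, posop A -> posop B -> posop (sigma A B),
      forall A B C D, posop A -> posop B -> posop C -> posop D ->
        A <=op C -> B <=op D -> sigma A B <=op sigma C D,
      forall A B C, posop A -> posop B -> posop C ->
        compop (compop C (sigma A B)) C <=op
          sigma (compop (compop C A) C) (compop (compop C B) C) &
      forall (A_ B_ : nat -> boundedOp H) A B,
        (forall n, posop (A_ n)) -> (forall n, posop (B_ n)) ->
        posop A -> posop B ->
        decreases_to A_ A -> decreases_to B_ B ->
        decreases_to (fun n => sigma (A_ n) (B_ n)) (sigma A B)].

Definition operator_mean (H : hilbertSpace R)
    (sigma : boundedOp H -> boundedOp H -> boundedOp H) : Prop :=
  connection sigma /\ forall A, posop A -> sigma A A = A.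

Definition representing_function (H : hilbertSpace R)
    (sigma : boundedOp H -> boundedOp H -> boundedOp H) (f : R -> R) : Prop :=
  operator_monotone f /\
  forall x, 0 <= x -> scalop (f x)%:C = sigma idop (scalop x%:C).

(* 1 !_t x; the value at x = 0 is the limit as x decreases to 0, and has to be
   given separately because 0^-1 = 0. *)
Definition wharmonic1 (t x : R) : R :=
  if x == 0 then (t == 0)%:R else ((1 - t) + t * x^-1)^-1.

(* Borel measures on [0, 1] are represented by Borel measures on R which vanish
   outside [0, 1]. *)
Definition on_unit_interval
    (mu : {finite_measure set (measurableTypeR R) -> \bar R}) : Prop :=
  mu (~` `[0, 1]) = 0%E.

Definition associated_measure (f : R -> R)
    (mu : {finite_measure set (measurableTypeR R) -> \bar R}) : Prop :=
  on_unit_interval mu /\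
  forall x, 0 <= x ->
    (f x)%:E = (\int[mu]_(t in `[0%R, 1%R]) (wharmonic1 t x)%:E)%E.

(* The Kubo-Ando correspondence for H, between connections, operator monotone
   functions and finite measures. It does not hold for every H (it fails in
   dimension one, for instance), but it does in infinite dimension. *)
Definition kubo_ando (H : hilbertSpace R) : Prop :=
  [/\ (forall sigma : boundedOp H -> boundedOp H -> boundedOp H,
        connection sigma ->
        exists2 f, representing_function sigma f &
          forall g, representing_function sigma g ->
            forall x, 0 <= x -> g x = f x),
      (forall (sigma tau : boundedOp H -> boundedOp H -> boundedOp H) f,
        connection sigma -> connection tau ->
        representing_function sigma f -> representing_function tau f ->
        forall A B, posop A -> posop B -> sigma A B = tau A B),
      (forall f, operator_monotone f ->
        exists2 sigma : boundedOp H -> boundedOp H -> boundedOp H,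
          connection sigma & representing_function sigma f),
      (forall (sigma : boundedOp H -> boundedOp H -> boundedOp H) f,
        connection sigma -> representing_function sigma f ->
        exists2 mu, associated_measure f mu &
          forall nu, associated_measure f nu ->
            forall E, measurable E -> nu E = mu E) &
      (forall mu, on_unit_interval mu ->
        exists (sigma : boundedOp H -> boundedOp H -> boundedOp H) f,
          [/\ connection sigma, representing_function sigma f &
              associated_measure f mu])].

Definition strict_at_right (H : hilbertSpace R)
    (sigma : boundedOp H -> boundedOp H -> boundedOp H) : Prop :=
  forall A B, strict_posop A -> strict_posop B -> sigma A B = B -> A = B.

Definition right_trivial (H : hilbertSpace R)
    (sigma : boundedOp H -> boundedOp H -> boundedOp H) : Prop :=
  forall A B, posop A -> posop B -> sigma A B = B.

End KuboAndo.

(* Main.v *)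
Require Import Defs.
From HB Require Import structures.
From mathcomp Require Import all_boot all_order all_algebra.
From mathcomp Require Import all_classical all_reals all_analysis.
From mathcomp Require Import measurable_realfun complex ring lra.

Set Implicit Arguments.
Unset Strict Implicit.
Unset Printing Implicit Defensive.

Import Order.TTheory GRing.Theory Num.Theory.
Import numFieldNormedType.Exports.

Local Open Scope classical_set_scope.
Local Open Scope complex_scope.
Local Open Scope ring_scope.

(** Two features of a mean sigma with representing function f carry the proof.

    Homogeneity: A sigma (a A) = f(a) A for every positive A. For fixed a, both
    (A, B) |-> A sigma (a A) and (A, B) |-> f(a) A are connections represented
    by the constant function f(a), so the Kubo-Ando correspondence identifies
    them (connection_homogeneous).

    Strict monotony off the fixed point: the integrand 1 !_t b lies above b when
    b < 1 and below b when b > 1, with equality only at t = 1. Since mu has mass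
    f(1) = 1, either mu is the Dirac measure at 1, or b < f(b) on (0, 1) and
    f(b) < b on (1, +oo) (associated_strict).

    Suppose mu is not the Dirac measure and A sigma B <= B with B > 0. Some
    multiple a A with a > 0 is below B, and whenever b A <= B with 0 < b < 1,
    monotony gives f(b) A = A sigma (b A) <= A sigma B <= B, where f(b) > b. The
    supremum of the admissible factors can therefore not be smaller than 1, so
    A <= B (leop_continuation, connection_le_right). If B <= A sigma B instead,
    the same argument on the factors b with b B <= A, after replacing A by the
    invertible A + e I, gives B <= A (connection_ge_right). The other operator
    inequalities are the special cases A = I or B = I of these two implications,
    and the strictness statements follow by antisymmetry of the operator order.

    Conversely, if mu is the Dirac measure at 1, then f is the identity, and the
    correspondence forces A sigma B = B; the scalar operators 0, I / 2 and 2 I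
    then refute each of the operator statements. This needs a nonzero vector in
    H, and the correspondence provides one: on the zero space all operators
    coincide, so that every operator monotone function would represent every connection,
    against uniqueness (kubo_ando_nontrivial). *)

(** * The quadratic form of a positive operator *)

Section QuadraticForm.
Context {R : realType} {H : hilbertSpace R}.
Implicit Types (A B X Y : boundedOp H) (x y : H) (a : R).

(** For positive A nothing is lost by the real part (posop_hdotE); working with
    it moves the order on operators into the real field R. In particular,
    qform idop x is the squared norm of x. *)
Definition qform A x : R := complex.Re (hdot H (A x) x).

Definition scaleop a A : boundedOp H := compop (scalop a%:C) A.

Lemma posop_hdotE A x : posop A -> hdot H (A x) x = (qform A x)%:C.
Proof. by move=> /(_ x) /ger0_real/RRe_real <-. Qed.

Lemma leop_hdot A B :
  A <=op B <-> forall x, hdot H (A x) x <= hdot H (B x) x.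
Proof.
by split=> AB x; have := AB x; rewrite /= linearBl /= subr_ge0.
Qed.

Lemma leop_qform A B : posop A -> posop B ->
  A <=op B <-> forall x, qform A x <= qform B x.
Proof.
move=> A0 B0; rewrite leop_hdot; split=> AB x; have := AB x;
  by rewrite !posop_hdotE// lecR.
Qed.

Lemma qform_ge0 A x : posop A -> 0 <= qform A x.
Proof. by move=> A0; rewrite -lecR -posop_hdotE//; exact: A0. Qed.

Lemma leop_refl A : A <=op A.
Proof. by rewrite leop_hdot. Qed.

Lemma leop_trans A B X : A <=op B -> B <=op X -> A <=op X.
Proof. by rewrite !leop_hdot => AB BX x; exact: le_trans (AB x) (BX x). Qed.

Lemma scaleopE a A x : scaleop a A x = a%:C *: A x.
Proof. by []. Qed.

Lemma boundedOpB A x y : A (x - y) = A x - A y.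
Proof.
by rewrite addrC -scaleN1r boundedOp_linear scaleN1r [RHS]addrC.
Qed.

Lemma boundedOpZ A (c : R[i]) x : A (c *: x) = c *: A x.
Proof.
have A0 : A 0 = 0 by rewrite -{1}(subrr x) boundedOpB subrr.
by rewrite -[c *: x]addr0 boundedOp_linear A0 addr0.
Qed.

Lemma boundedOpD A x y : A (x + y) = A x + A y.
Proof. by rewrite -[x]scale1r boundedOp_linear !scale1r. Qed.

Lemma hdot_scaleop a A x :
  hdot H (scaleop a A x) x = a%:C * hdot H (A x) x.
Proof. by rewrite scaleopE linearZl_LR. Qed.

Lemma qform_scaleop a A x : qform (scaleop a A) x = a * qform A x.
Proof.
rewrite /qform hdot_scaleop; case: (hdot H _ _) => u v /=.
by rewrite mul0r subr0.
Qed.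

Lemma posop_scaleop a A : 0 <= a -> posop A -> posop (scaleop a A).
Proof.
move=> a0 A0 x; rewrite hdot_scaleop; apply: mulr_ge0; last exact: A0.
by rewrite ler0c.
Qed.

Lemma posop_scalop a : 0 <= a -> posop (scalop a%:C : boundedOp H).
Proof.
move=> a0 x; rewrite linearZl_LR /=.
by rewrite hdot_norm mulr_ge0 ?ler0c // exprn_ge0.
Qed.

Lemma posop_id : posop (idop : boundedOp H).
Proof. exact: (posop_scalop ler01). Qed.

Lemma scaleop_id a : scaleop a idop = scalop a%:C.
Proof. by apply: boundedOpP => x /=; rewrite scale1r. Qed.

Lemma compop_scaleop a A X :
  compop (compop X (scaleop a A)) X = scaleop a (compop (compop X A) X).
Proof. by apply: boundedOpP => x /=; rewrite boundedOpZ. Qed.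

Lemma qform_id x : hdot H x x = (qform idop x)%:C.
Proof. by rewrite -(posop_hdotE _ posop_id) /= scale1r. Qed.

(** Polarization: the quadratic form is real at x + y and at x + i y. *)
Lemma posop_hermitian A x y : posop A -> hdot H (A x) y = (hdot H (A y) x)^*.
Proof.
move=> A0.
have re z : complex.Im (hdot H (A z) z) = 0 by apply: ger0_Im; exact: A0.
have := re (x + y); have := re (x + 'i%C *: y); have := re x; have := re y.
rewrite !boundedOpD boundedOpZ !linearDl /= !linearDr /=.
rewrite !linearZl_LR !linearZr_LR /=.
case: (hdot H (A x) x) => a b; case: (hdot H (A y) y) => c d.
case: (hdot H (A x) y) => e f; case: (hdot H (A y) x) => g h /=.
by move=> *; simpc; congr (_ +i* _); lra.
Qed.

Lemma boundedOp_bounded A :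
  exists2 K, 0 < K & forall x, qform idop (A x) <= K ^+ 2 * qform idop x.
Proof.
pose L : {linear H -> H} := HB.pack (boundedOp_fun A)
  (GRing.isLinear.Build _ _ _ _ _ (boundedOp_linear A)).
have /linear_bounded_continuous/linear_boundedP/pinfty_ex_gt0 : continuous L.
  exact: boundedOp_continuous.
move=> [r r0 Lr]; have rE := RRe_real (gtr0_real r0).
exists (complex.Re r); first by rewrite -ltcR rE.
move=> x; rewrite -lecR rmorphM rmorphXn /= rE -!qform_id !hdot_norm -exprMn.
by rewrite lerXn2r ?nnegrE ?mulr_ge0 ?(ltW r0) ?normr_ge0 //; exact: Lr.
Qed.
End QuadraticForm.

(** * Bounds in the operator order *)

Section OperatorOrder.
Context {R : realType} {H : hilbertSpace R}.
Implicit Types (A B X Y : boundedOp H) (x y : H) (a : R).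

Lemma qform_subZ A x y a : posop A ->
  qform A (x - a%:C *: y) =
  qform A x - 2 * a * complex.Re (hdot H (A x) y) + a ^+ 2 * qform A y.
Proof.
move=> A0; rewrite /qform boundedOpB boundedOpZ linearBl /= !linearBr /=.
rewrite !linearZl_LR !linearZr_LR /= (posop_hermitian y x A0).
have := ger0_Im (A0 y).
case: (hdot H (A x) x) => u1 u2; case: (hdot H (A x) y) => v1 v2.
by case: (hdot H (A y) y) => w1 w2 /= ->; simpc; rewrite /GRing.scale /=; ring.
Qed.

(** The instance of the Cauchy-Schwarz inequality for x and A x comes from
    expanding |x - A x / K|^2 >= 0, where K bounds the norm of A. *)
Lemma posop_bounded A : posop A ->
  exists2 M, 0 < M & A <=op scalop M%:C.
Proof.
move=> A0; have [K K0 AK] := boundedOp_bounded A.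
exists K => //; rewrite -scaleop_id leop_qform//; last first.
  by apply: posop_scaleop; [exact: ltW|exact: posop_id].
move=> x; rewrite qform_scaleop.
have := qform_ge0 (x - (K^-1)%:C *: A x) posop_id.
rewrite qform_subZ; last exact: posop_id.
have -> : complex.Re (hdot H (idop x) (A x)) = qform A x.
  rewrite (posop_hermitian x (A x) posop_id) /= scale1r.
  by rewrite /qform; case: (hdot H (A x) x).
have q1 : K^-1 ^+ 2 * qform idop (A x) <= qform idop x.
  by rewrite exprVn ler_pdivrMl ?exprn_gt0.
move=> q2; have q3 : K^-1 * qform A x <= qform idop x by lra.
by rewrite -ler_pdivrMl.
Qed.

(** The Cauchy-Schwarz inequality for the semidefinite form of A, at x and A x:
    it comes from the positivity of this form at x - A x / M, where A <= M I. *)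
Lemma posop_image_bound A : posop A ->
  exists2 M, 0 < M & forall x, qform idop (A x) <= M * qform A x.
Proof.
move=> A0; have [M M0] := posop_bounded A0.
rewrite -scaleop_id leop_qform//; last first.
  by apply: posop_scaleop; [exact: ltW|exact: posop_id].
move=> AM.
exists M => // x; have := qform_ge0 (x - (M^-1)%:C *: A x) A0.
rewrite qform_subZ//.
have -> : complex.Re (hdot H (A x) (A x)) = qform idop (A x).
  by rewrite qform_id.
have := AM (A x); rewrite qform_scaleop.
set u := qform A (A x); set v := qform idop (A x) => uv.
have q1 : M^-1 ^+ 2 * u <= M^-1 * v.
  by rewrite expr2 -mulrA ler_pM2l ?invr_gt0// ler_pdivrMl.
move=> q2; have q3 : M^-1 * v <= qform A x by lra.
by rewrite -ler_pdivrMl.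
Qed.

(** If S is the inverse of B, then |x| = |S (B x)| is controlled by |B x|, hence
    by the form of B through posop_image_bound. *)
Lemma strict_posop_bounded_below B : strict_posop B ->
  exists2 c, 0 < c & scalop c%:C <=op B.
Proof.
move=> [B0 [S [_ SB]]]; have [M M0 BM] := posop_image_bound B0.
have [K K0 SK] := boundedOp_bounded S.
exists (K ^+ 2 * M)^-1; first by rewrite invr_gt0 mulr_gt0 ?exprn_gt0.
have c0 : 0 < K ^+ 2 * M by rewrite mulr_gt0 ?exprn_gt0.
rewrite -scaleop_id leop_qform//; last first.
  by apply: posop_scaleop; [rewrite invr_ge0 ltW|exact: posop_id].
move=> x; rewrite qform_scaleop ler_pdivrMl// -mulrA.
have SBx : S (B x) = x.
  by have /(congr1 (fun T : boundedOp H => T x)) := SB; rewrite /= scale1r.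
by rewrite -{1}SBx; apply: (le_trans (SK _)); rewrite ler_pM2l ?exprn_gt0.
Qed.

(** The form of D = B - A vanishes, so posop_image_bound gives D x = 0. *)
Lemma leop_antisym A B : A <=op B -> B <=op A -> A = B.
Proof.
move=> AB BA; apply: boundedOpP => x; apply/eqP; rewrite eq_sym -subr_eq0.
have [M M0 /(_ x)] := posop_image_bound AB.
have -> : qform (subop B A) x = 0.
  rewrite /qform /= linearBl /=.
  move: AB BA; rewrite !leop_hdot => /(_ x) AB /(_ x) BA.
  by rewrite (le_anti (introT andP (conj AB BA))) subrr.
rewrite mulr0 -lecR -qform_id hdot_norm /= => D0.
rewrite -normr_eq0 -sqrf_eq0 eq_le exprn_ge0// andbT; exact: D0.
Qed.

(** A continuation argument: the factors b >= 0 with b X <= Y form a closed set,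
    so their supremum is one of them, and it cannot be smaller than 1. *)
Lemma leop_continuation X Y a : posop X -> posop Y ->
  0 < a -> scaleop a X <=op Y ->
  (forall b, 0 < b < 1 -> scaleop b X <=op Y ->
    exists2 b', b < b' & scaleop b' X <=op Y) ->
  X <=op Y.
Proof.
move=> X0 Y0 a0 aXY step; apply: contrapT => nXY.
pose S := [set b : R | 0 <= b /\ scaleop b X <=op Y].
have SE b : 0 <= b -> S b <-> forall x, b * qform X x <= qform Y x.
  move=> b0; rewrite /S /=; split=> [[_]|bXY].
    rewrite leop_qform//; last exact: posop_scaleop.
    by move=> bXY x; have := bXY x; rewrite qform_scaleop.
  split=> //; rewrite leop_qform//; last exact: posop_scaleop.
  by move=> x; rewrite qform_scaleop.
have S1 b : S b -> b < 1.
  move=> Sb; rewrite ltNge; apply/negP => b1; apply: nXY.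
  rewrite leop_qform// => x.
  have := (SE _ (le_trans ler01 b1)).1 Sb x.
  by apply: le_trans; rewrite ler_peMl// qform_ge0.
have Sa : S a by split=> //; exact: ltW.
have Sub : ubound S 1 by move=> b /S1/ltW.
have as_ : a <= sup S by apply: ub_le_sup => //; exists 1.
have s0 : 0 < sup S by exact: lt_le_trans as_.
have Ss : S (sup S).
  apply/SE; first exact: ltW.
  move=> x; have := qform_ge0 x X0; rewrite le_eqVlt => /predU1P[<-|Xx0].
    by rewrite mulr0 qform_ge0.
  rewrite -ler_pdivlMr//; apply: ge_sup; first by exists a.
  move=> b Sb; rewrite ler_pdivlMr//; exact: ((SE b Sb.1).1 Sb x).
have [|b' sb' b'XY] := step (sup S) _ Ss.2; first by rewrite s0 S1.
have : b' <= sup S.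
  apply: ub_le_sup; first by exists 1.
  by split=> //; apply/ltW/(lt_trans s0).
by rewrite leNgt sb'.
Qed.

Lemma leop_add_eps A B : posop A -> posop B ->
  (forall e, 0 < e -> forall x, qform B x <= qform A x + e * qform idop x) ->
  B <=op A.
Proof.
move=> A0 B0 AB; rewrite leop_qform// => x; apply/ler_addgt0Pr => e e0.
have q0 : 0 <= qform idop x by exact/qform_ge0/posop_id.
have q1 : 0 < qform idop x + 1 by lra.
have := AB _ (divr_gt0 e0 q1) x; move/le_trans; apply; rewrite lerD2l.
by rewrite -mulrA ler_piMr ?(ltW e0)// ler_pdivrMl// mulr1; lra.
Qed.
End OperatorOrder.

(** * Connections and the Kubo-Ando correspondence *)

Section Connections.
Context {R : realType} {H : hilbertSpace R}.
Implicit Types (A B C : boundedOp H).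
Implicit Types (sigma : boundedOp H -> boundedOp H -> boundedOp H).

Lemma leop_scaleop a A B : 0 <= a -> A <=op B -> scaleop a A <=op scaleop a B.
Proof.
move=> a0; rewrite !leop_hdot => AB x; rewrite !hdot_scaleop.
by rewrite ler_wpM2l ?ler0c.
Qed.

Lemma decreases_to_scaleop a (A_ : nat -> boundedOp H) A : 0 <= a ->
  decreases_to A_ A -> decreases_to (fun n => scaleop a (A_ n)) (scaleop a A).
Proof.
move=> a0 [A_le A_cvg]; split=> [n|x]; first exact: leop_scaleop.
by apply: cvgZr; exact: A_cvg.
Qed.

Lemma connection_scaleop_left a : 0 <= a ->
  connection (fun A _ : boundedOp H => scaleop a A).
Proof.
move=> a0; split.
- by move=> A B A0 _; exact: posop_scaleop.
- by move=> A B C D _ _ _ _ AC _; exact: leop_scaleop.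
- by move=> A B C _ _ _; rewrite compop_scaleop; exact: leop_refl.
- by move=> A_ B_ A B _ _ _ _ A_A _; exact: decreases_to_scaleop.
Qed.

Lemma connection_right : connection (fun _ B : boundedOp H => B).
Proof. by split=> // A B C _ _ _; exact: leop_refl. Qed.

Lemma connection_diag sigma a : 0 <= a -> connection sigma ->
  connection (fun A _ => sigma A (scaleop a A)).
Proof.
move=> a0 [s_pos s_le s_conj s_decr]; split.
- by move=> A B A0 _; apply: s_pos => //; exact: posop_scaleop.
- move=> A B C D A0 _ C0 _ AC _; apply: s_le => //; first exact: posop_scaleop.
    exact: posop_scaleop.
  exact: leop_scaleop.
- move=> A B C A0 _ C0; rewrite -compop_scaleop.
  by apply: s_conj => //; exact: posop_scaleop.
- move=> A_ B_ A B A_0 _ A0 _ A_A _.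
  apply: s_decr => // [n||]; [exact: posop_scaleop|exact: posop_scaleop|].
  exact: decreases_to_scaleop.
Qed.

Lemma scalop_le v a b : v != 0 :> H ->
  (scalop a%:C : boundedOp H) <=op scalop b%:C -> a <= b.
Proof.
move=> v0; rewrite leop_hdot => /(_ v); rewrite /= !linearZl_LR /= hdot_norm.
by rewrite ler_pM2r ?lecR// exprn_gt0// normr_gt0.
Qed.

Lemma scalop_inj v a b : v != 0 :> H ->
  scalop a%:C = scalop b%:C :> boundedOp H -> a = b.
Proof.
move=> v0 ab; apply/eqP; rewrite eq_le.
by rewrite !(scalop_le v0)// ab; exact: leop_refl.
Qed.

(** The constant f a is operator monotone because the correspondence attaches an
    operator monotone function g to the connection (A, B) |-> f(a) A, and g can
    only be that constant. *)
Lemma connection_homogeneous sigma f a A :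
  kubo_ando H -> connection sigma -> representing_function sigma f ->
  (exists v : H, v != 0) -> 0 <= a -> posop A ->
  sigma A (scaleop a A) = scaleop (f a) A.
Proof.
move=> [KA_f KA_inj _ _ _] s_conn [[_ f_ge0 _] s_f] [v v0] a0 A0.
have c_conn := connection_scaleop_left (f_ge0 _ a0).
have [g [g_om c_g] _] := KA_f _ c_conn.
apply: (KA_inj _ _ g (connection_diag a0 s_conn) c_conn) => //; split=> // x x0.
by rewrite c_g// !scaleop_id -s_f.
Qed.

(** The right-trivial mean is a connection which also has f as its representing
    function, so it is sigma. *)
Lemma representing_id_right_trivial sigma f :
  kubo_ando H -> connection sigma -> representing_function sigma f ->
  (forall x, 0 <= x -> f x = x) -> right_trivial sigma.
Proof.
move=> [_ KA_inj _ _ _] s_conn s_f f_id A B A0 B0.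
apply: (KA_inj _ _ f s_conn connection_right s_f) => //.
by split=> [|x x0]; [exact: s_f.1|rewrite f_id].
Qed.

Lemma invertible_scalop a : a != 0 -> invertible_op (scalop a%:C : boundedOp H).
Proof.
move=> a0; exists (scalop (a^-1)%:C).
have ca0 : a%:C != 0 by rewrite eq_complex /= negb_and a0.
by split; apply: boundedOpP => x /=;
  rewrite scalerA scale1r -rmorphM /= ?divff ?mulVf// scale1r.
Qed.

Lemma strict_posop_scalop a : 0 < a -> strict_posop (scalop a%:C : boundedOp H).
Proof.
move=> a0; split; first exact/posop_scalop/ltW.
by apply: invertible_scalop; rewrite gt_eqF.
Qed.
End Connections.

(** * The associated measure *)

Section AssociatedMeasure.
Context {R : realType}.
Implicit Types (f : R -> R) (t x : R).

Local Notation unit_itv := (`[0%R, 1%R]%classic : set (measurableTypeR R)).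

Lemma wharmonic1_mean_gt0 t x : 0 < x -> 0 <= t <= 1 -> 0 < (1 - t) + t * x^-1.
Proof.
move=> x0 /andP[t0 t1]; have [->|tn1] := eqVneq t 1.
  by rewrite subrr add0r mul1r invr_gt0.
have ? : t < 1 by rewrite lt_neqAle tn1.
have : 0 <= t * x^-1 by rewrite mulr_ge0// invr_ge0 ltW.
by lra.
Qed.

Lemma wharmonic1_den_gt0 t x : 0 < x -> 0 <= t <= 1 -> 0 < x * (1 - t) + t.
Proof.
move=> x0 t01; have := mulr_gt0 x0 (wharmonic1_mean_gt0 x0 t01).
by rewrite mulrDr [t * _]mulrC mulrA divff ?gt_eqF// mul1r.
Qed.

Lemma measurable_wharmonic1 x : 0 <= x ->
  measurable_fun unit_itv (wharmonic1^~ x).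
Proof.
rewrite le_eqVlt => /predU1P[<-|x0].
  rewrite (_ : wharmonic1^~ 0 = \1_[set 0 : R]); last first.
    by apply/funext => t; rewrite /wharmonic1 eqxx indicE in_set1.
  exact: measurable_indic.
rewrite /wharmonic1 gt_eqF//.
apply: subspace_continuous_measurable_fun => //.
apply: continuous_in_subspaceT => t /set_mem; rewrite /= in_itv /= => t01.
apply: cvgV; first by rewrite gt_eqF// wharmonic1_mean_gt0.
apply: cvgD; first by apply: cvgB => //; exact: cvg_cst.
by apply: cvgMl; exact: cvg_id.
Qed.

Lemma wharmonic1_ge0 t x : 0 <= x -> 0 <= t <= 1 -> 0 <= wharmonic1 t x.
Proof.
rewrite le_eqVlt /wharmonic1 => /predU1P[<-|x0] t01.
  by rewrite eqxx ler0n.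
by rewrite gt_eqF// invr_ge0 ltW// wharmonic1_mean_gt0.
Qed.

Lemma wharmonic1_right x : wharmonic1 1 x = x.
Proof.
rewrite /wharmonic1; case: eqVneq => [->|_]; first by rewrite oner_eq0.
by rewrite subrr add0r mul1r invrK.
Qed.

(** The right-hand side has the sign of 1 - x, except that it vanishes at t = 1. *)
Lemma wharmonic1_gap t x : 0 < x -> 0 <= t <= 1 ->
  wharmonic1 t x - x = x * (1 - t) * (1 - x) / (x * (1 - t) + t).
Proof.
move=> x0 t01; have d0 := wharmonic1_mean_gt0 x0 t01.
have n0 := wharmonic1_den_gt0 x0 t01.
rewrite /wharmonic1 gt_eqF//; field.
by rewrite !gt_eqF.
Qed.

Lemma wharmonic1_ge t x : 0 < x <= 1 -> 0 <= t <= 1 -> x <= wharmonic1 t x.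
Proof.
move=> /andP[x0 x1] /[dup] t01 /andP[t0 t1].
rewrite -subr_ge0 wharmonic1_gap// divr_ge0//.
  by rewrite !mulr_ge0 ?subr_ge0// ltW.
by rewrite addr_ge0// mulr_ge0 ?subr_ge0// ltW.
Qed.

Lemma wharmonic1_le t x : 1 <= x -> 0 <= t <= 1 -> wharmonic1 t x <= x.
Proof.
move=> x1 /[dup] t01 /andP[t0 t1]; have x0 := lt_le_trans ltr01 x1.
rewrite -subr_le0 wharmonic1_gap// mulr_le0_ge0//.
  by rewrite mulr_ge0_le0 ?subr_le0// mulr_ge0 ?subr_ge0// ltW.
by rewrite invr_ge0 addr_ge0// mulr_ge0 ?subr_ge0// ltW.
Qed.

Lemma wharmonic1_eq t x : 0 < x -> x != 1 -> 0 <= t <= 1 ->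
  wharmonic1 t x = x -> t = 1.
Proof.
move=> x0 x1 t01 /eqP; rewrite -subr_eq0 wharmonic1_gap// => /eqP wx.
have n0 := wharmonic1_den_gt0 x0 t01.
move/eqP: wx; rewrite !mulf_eq0 invr_eq0 (gt_eqF n0) (gt_eqF x0) /=.
by rewrite orbF !subr_eq0 [1 == x]eq_sym (negPf x1) orbF => /eqP.
Qed.

Lemma associated_dirac f (a : R) : 0 <= a <= 1 ->
  associated_measure f (@dirac _ (measurableTypeR R) a R) ->
  forall x, 0 <= x -> f x = wharmonic1 a x.
Proof.
move=> a01 [_ f_int] x x0; apply/EFin_inj; rewrite f_int// integral_dirac//.
  by rewrite diracE mem_set ?mul1e//= in_itv.
by apply/measurable_EFinP; exact: measurable_wharmonic1.
Qed.

Section Gap.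
Context (f : R -> R) (mu : {finite_measure set (measurableTypeR R) -> \bar R})
  (f_mu : associated_measure f mu) (f1 : f 1 = 1).

Lemma associated_mass : mu unit_itv = 1%E.
Proof.
have := f_mu.2 _ ler01; rewrite f1.
under eq_integral do rewrite /wharmonic1 oner_eq0 invr1 mulr1 subrK invr1.
by rewrite integral_cst//= mul1e.
Qed.

(* The absolute value lets ae_eq_integral_abs treat x < 1 and x > 1 together. *)
Let gap x t := (`|wharmonic1 t x - x|)%:E.

Let measurable_gap x : 0 <= x -> measurable_fun unit_itv (gap x).
Proof.
move=> x0; apply/measurable_EFinP; apply: measurableT_comp => //.
by apply: measurable_funB => //; exact: measurable_wharmonic1.
Qed.

Let integral_cstx x : (\int[mu]_(t in unit_itv) x%:E = x%:E)%E.
Proof. by rewrite integral_cst// [X in (_ * X)%E]associated_mass mule1. Qed.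

Let measurable_w x : 0 <= x ->
  measurable_fun unit_itv (fun t => (wharmonic1 t x)%:E).
Proof. by move=> x0; apply/measurable_EFinP; exact: measurable_wharmonic1. Qed.

Lemma associated_gap_le1 x : 0 < x <= 1 ->
  ((f x)%:E = x%:E + \int[mu]_(t in unit_itv) gap x t)%E.
Proof.
move=> /[dup] x01 /andP[x0 x1]; rewrite f_mu.2 ?(ltW x0)//.
rewrite -[in RHS](integral_cstx x) -ge0_integralD//=.
- apply: eq_integral => t /set_mem; rewrite /= in_itv /= => t01.
  by rewrite -EFinD ger0_norm ?subr_ge0 ?wharmonic1_ge// subrKC.
- by move=> t _; rewrite lee_fin ltW.
- by move=> t _; rewrite lee_fin.
- by apply: measurable_gap; exact: ltW.
Qed.

Lemma associated_gap_ge1 x : 1 <= x ->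
  (x%:E = (f x)%:E + \int[mu]_(t in unit_itv) gap x t)%E.
Proof.
move=> x1; have x0 := lt_le_trans ltr01 x1; rewrite f_mu.2 ?(ltW x0)//.
rewrite -[in LHS](integral_cstx x) -ge0_integralD//=.
- apply: eq_integral => t /set_mem; rewrite /= in_itv /= => t01.
  by rewrite -EFinD ler0_norm ?subr_le0 ?wharmonic1_le// opprB subrKC.
- move=> t; rewrite /= in_itv /= => t01.
  by rewrite lee_fin wharmonic1_ge0// ltW.
- by apply: measurable_w; exact: ltW.
- by move=> t _; rewrite lee_fin.
- by apply: measurable_gap; exact: ltW.
Qed.

(** If f(x) = x, then |(1 !_t x) - x| has integral 0; it vanishes only at t = 1,
    so mu is concentrated there. *)
Lemma associated_fixpoint_dirac x : 0 < x -> x != 1 -> f x = x ->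
  forall E : set (measurableTypeR R), measurable E -> mu E = \d_(1 : R) E.
Proof.
move=> x0 x1 fx.
have : (\int[mu]_(t in unit_itv) `|gap x t| = 0)%E.
  under eq_integral do rewrite gee0_abs ?lee_fin//.
  have cancel (y : \bar R) : (x%:E = x%:E + y)%E -> y = 0%E.
    case: y => [r [/eqP]| |]//.
    by rewrite -subr_eq0 opprD addNKr oppr_eq0 => /eqP ->.
  apply: cancel; have [x_le1|/ltW x_ge1] := leP x 1.
    by rewrite -associated_gap_le1 ?fx// x0.
  by rewrite -[in X in (X + _)%E]fx -associated_gap_ge1.
have mgap := measurable_gap (ltW x0).
move/(ae_eq_integral_abs mu (measurable_itv _) mgap) => gap0.
have ptm : measurable ([set 1] : set (measurableTypeR R)).
  exact: measurable_set1.
have C1 : mu.-negligible (~` [set 1]).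
  apply: negligibleS (negligibleU gap0 _); last first.
    apply/negligibleP; last exact: f_mu.1.
    by apply: measurableC; exact: measurable_itv.
  move=> t /= t1; have [t01|nt01] := boolP (t \in `[0, 1]); [left|by right].
  move=> /(_ isT) [/eqP]; rewrite normr_eq0 subr_eq0 => /eqP wx.
  by apply: t1; apply: (wharmonic1_eq x0 x1 _ wx); rewrite in_itv in t01.
have restr E : measurable E -> mu E = mu (E `&` [set 1]).
  move=> mE; have DE : mu (E `\` [set 1]) = 0%E.
    apply: measure_negligible; first exact: measurableD.
    by apply: negligibleS C1 => t [].
  by rewrite (measureDI mu mE ptm) [X in (X + _)%E]DE add0e.
have mass1 : mu [set 1] = 1%E.
  rewrite -associated_mass (restr unit_itv)//.
  congr (mu _); apply/seteqP; split=> [t /= ->|t []//].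
  by rewrite in_itv /= ler01 lexx.
move=> E mE; rewrite restr// diracE.
have [/set_mem E1|/negP nE1] := boolP (1 \in E).
  rewrite (_ : E `&` [set 1] = [set 1]) ?mass1//.
  by apply/seteqP; split=> [t []//|t ->].
rewrite (_ : E `&` [set 1] = set0) ?measure0//.
by apply/seteqP; split=> // t [Et /= t1]; apply: nE1; rewrite -t1 inE.
Qed.

Lemma associated_strict :
  ~ (forall E : set (measurableTypeR R), measurable E -> mu E = \d_(1 : R) E) ->
  (forall b, 0 < b < 1 -> b < f b) /\ (forall b, 1 < b -> f b < b).
Proof.
move=> mu1; split=> b.
  move=> /andP[b0 b1]; have bn1 : b != 1 by rewrite lt_eqF.
  have fn : f b != b.
    by apply/eqP => fb; apply: mu1;
      exact: (associated_fixpoint_dirac b0 bn1 fb).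
  rewrite lt_neqAle eq_sym fn -lee_fin associated_gap_le1 ?b0 ?(ltW b1)//.
  by rewrite leeDl// integral_ge0// => t _; rewrite lee_fin.
move=> b1; have bn1 : b != 1 by rewrite gt_eqF.
have b0 := lt_trans ltr01 b1.
have fn : f b != b.
  by apply/eqP => fb; apply: mu1; exact: (associated_fixpoint_dirac b0 bn1 fb).
rewrite lt_neqAle fn -lee_fin [leRHS](associated_gap_ge1 (ltW b1)).
by rewrite leeDl// integral_ge0// => t _; rewrite lee_fin.
Qed.
End Gap.
End AssociatedMeasure.

(** * Strictness *)

Section Strictness.
Context {R : realType} {H : hilbertSpace R}.
Implicit Types (A B : boundedOp H).

Lemma on_unit_interval_dirac (a : R) : 0 <= a <= 1 ->
  on_unit_interval (@dirac _ (measurableTypeR R) a R).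
Proof.
by move=> a01; rewrite /on_unit_interval /= diracE memNset//=.
Qed.

(** On the zero space, the functions of the Dirac measures at 0 and at 1,
    whose values at 1/2 are 1 and 1/2, would represent the same connection. *)
Lemma kubo_ando_nontrivial : kubo_ando H -> exists v : H, v != 0.
Proof.
move=> [KA_f _ _ _ KA_mu]; apply: contrapT => H0.
have allE A B : A = B.
  apply: boundedOpP => x; suff z (v : H) : v = 0 by rewrite [LHS]z [RHS]z.
  by apply: contrapT => /eqP v0; apply: H0; exists v.
have i0 : 0 <= (0 : R) <= 1 by rewrite lexx ler01.
have i1 : 0 <= (1 : R) <= 1 by rewrite lexx ler01.
have [s0 [f0 [s0_conn s0_f0 f0_mu]]] := KA_mu _ (on_unit_interval_dirac i0).
have [s1 [f1 [_ s1_f1 f1_mu]]] := KA_mu _ (on_unit_interval_dirac i1).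
have [g _ g_uniq] := KA_f _ s0_conn.
have s0_f1 : representing_function s0 f1.
  by split=> [|x x0]; [exact: s1_f1.1|exact: allE].
have h0 : (0 : R) <= 2^-1 by lra.
have := g_uniq _ s0_f1 _ h0; rewrite -(g_uniq _ s0_f0 _ h0).
rewrite (associated_dirac i0 f0_mu)// (associated_dirac i1 f1_mu)//.
rewrite wharmonic1_right /wharmonic1 mul0r addr0 subr0 invr1.
by rewrite invr_eq0 pnatr_eq0 /= => /eqP; rewrite lt_eqF//; lra.
Qed.

Lemma leop_scaleopV a A B : 0 < a -> posop A -> posop B ->
  scaleop a A <=op B <-> A <=op scaleop a^-1 B.
Proof.
move=> a0 A0 B0; have a0' := ltW a0.
rewrite !leop_qform//; try by apply: posop_scaleop; rewrite ?invr_ge0.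
by split=> AB x; have := AB x; rewrite !qform_scaleop ler_pdivlMl.
Qed.

Lemma posop_le_strict_posop A B : posop A -> strict_posop B ->
  exists2 a, 0 < a & scaleop a A <=op B.
Proof.
move=> A0 B0; have [c c0 cB] := strict_posop_bounded_below B0.
have [M M0 AM] := posop_bounded A0.
have M0' := ltW M0; have c0' := ltW c0.
exists (c / M); first exact: divr_gt0.
apply: leop_trans cB; rewrite leop_hdot => x.
move: AM; rewrite leop_hdot => /(_ x).
rewrite hdot_scaleop /= !linearZl_LR /= => AM.
have -> : c%:C = (c / M)%:C * M%:C by rewrite -rmorphM /= divfK ?gt_eqF.
by rewrite -mulrA ler_wpM2l// ler0c divr_ge0.
Qed.

Definition add_scalar_op (e : R) A : boundedOp H := subop A (scalop (- e)%:C).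

Lemma hdot_add_scalar_op e A x :
  hdot H (add_scalar_op e A x) x = hdot H (A x) x + e%:C * hdot H x x.
Proof. by rewrite /= linearBl /= linearZl_LR /= rmorphN /= mulNr opprK. Qed.

Context (sigma : boundedOp H -> boundedOp H -> boundedOp H) (f : R -> R)
  (s_conn : connection sigma) (f_ge0 : forall x, 0 <= x -> 0 <= f x)
  (s_hom : forall a A, 0 <= a -> posop A ->
    sigma A (scaleop a A) = scaleop (f a) A).

(** If b A <= B, then f(b) A = A sigma (b A) <= A sigma B <= B, and f(b) > b. *)
Lemma connection_le_right A B : (forall b, 0 < b < 1 -> b < f b) ->
  posop A -> strict_posop B -> sigma A B <=op B -> A <=op B.
Proof.
move=> f_lt1 A0 sB AB; have B0 := sB.1.
have [a a0 aAB] := posop_le_strict_posop A0 sB.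
apply: (leop_continuation A0 B0 a0 aAB) => b b01 bAB.
have /andP[/ltW b0 _] := b01; exists (f b); first exact: f_lt1.
rewrite -s_hom//; apply: leop_trans AB; case: s_conn => _ s_le _ _.
by apply: s_le => //; [exact: posop_scaleop|exact: leop_refl].
Qed.

(** If b B <= A, then B <= A sigma B <= A sigma (b^-1 A) = f(b^-1) A, and
    f(b^-1) < b^-1 allows a factor larger than b. A positive multiple of B below
    A is needed to start, and need not exist when A is singular; therefore the
    argument is run on A + e I, and e tends to 0. *)
Lemma connection_ge_right A B : (forall b, 1 < b -> f b < b) ->
  posop A -> strict_posop B -> B <=op sigma A B -> B <=op A.
Proof.
move=> f_gt1 A0 [B0 _] AB.
apply: leop_add_eps => // e e0 x; pose Ae := add_scalar_op e A.
have AAe : A <=op Ae.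
  rewrite leop_hdot => y.
  rewrite hdot_add_scalar_op qform_id lerDl -rmorphM /= ler0c.
  by rewrite mulr_ge0 ?(ltW e0)// qform_ge0//; exact: posop_id.
have Ae0 : posop Ae.
  by move=> y; apply: le_trans (A0 y) _; move/leop_hdot : AAe; exact.
suff BAe : B <=op Ae.
  have := (leop_qform B0 Ae0).1 BAe x; congr (_ <= _).
  rewrite /qform hdot_add_scalar_op qform_id -rmorphM.
  by case: (hdot H (A x) x).
have BsAe : B <=op sigma Ae B.
  apply: leop_trans AB _; case: s_conn => _ s_le _ _.
  by apply: s_le => //; exact: leop_refl.
have [a a0 aBAe] : exists2 a, 0 < a & scaleop a B <=op Ae.
  have [M M0 BM] := posop_bounded B0.
  have M0' := ltW M0; have e0' := ltW e0.
  exists (e / M); first exact: divr_gt0.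
  rewrite leop_hdot => y; move: BM; rewrite leop_hdot => /(_ y).
  rewrite hdot_scaleop hdot_add_scalar_op /= linearZl_LR /= => BM.
  have -> : e%:C = (e / M)%:C * M%:C by rewrite -rmorphM /= divfK ?gt_eqF.
  rewrite -mulrA -[leLHS]add0r lerD//.
  by rewrite ler_wpM2l// ler0c divr_ge0.
apply: (leop_continuation B0 Ae0 a0 aBAe) => b /andP[b0 b1] bBAe.
have bV1 : 1 < b^-1 by rewrite invf_gt1.
have bV0 : 0 < b^-1 := lt_trans ltr01 bV1.
(* f b^-1 may vanish; the midpoint m lies above it and is positive. *)
pose m := (f b^-1 + b^-1) / 2.
have fb := f_ge0 (ltW bV0); have fb' := f_gt1 _ bV1.
have m0 : 0 < m by rewrite /m; lra.
exists m^-1; first by rewrite -[ltLHS]invrK ltf_pV2 ?posrE//; rewrite /m; lra.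
apply/leop_scaleopV; rewrite ?invr_gt0// invrK.
have BfAe : B <=op scaleop (f b^-1) Ae.
  rewrite -s_hom ?(ltW bV0)//; apply: leop_trans BsAe _.
  case: s_conn => _ s_le _ _.
  apply: s_le => //; [exact/posop_scaleop/Ae0/ltW|exact: leop_refl|].
  exact/leop_scaleopV.
apply: leop_trans BfAe _; rewrite leop_hdot => y; rewrite !hdot_scaleop.
by rewrite ler_wpM2r ?lecR//; rewrite /m; lra.
Qed.
End Strictness.

(** * The equivalence *)

Theorem theorem4p5 (R : realType) (H : hilbertSpace R) (KA : kubo_ando H)
    (sigma : boundedOp H -> boundedOp H -> boundedOp H)
    (sigma_mean : operator_mean sigma)
    (f : R -> R) (sigma_f : representing_function sigma f)
    (mu : {finite_measure set (measurableTypeR R) -> \bar R})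
    (f_mu : associated_measure f mu) :
  [<->
   (* 1 *)  strict_at_right sigma;
   (* 2 *)  ~ right_trivial sigma;
   (* 3 *)  forall A, posop A -> sigma A idop = idop -> A = idop;
   (* 4 *)  forall A, strict_posop A -> sigma idop A = A -> A = idop;
   (* 5 *)  forall A B, posop A -> strict_posop B -> sigma A B = B -> A = B;
   (* 6 *)  forall A, posop A -> idop <=op sigma A idop -> idop <=op A;
   (* 7 *)  forall A, posop A -> sigma A idop <=op idop -> A <=op idop;
   (* 8 *)  forall A, strict_posop A -> A <=op sigma idop A -> A <=op idop;
   (* 9 *)  forall A, strict_posop A -> sigma idop A <=op A -> idop <=op A;
   (* 10 *) forall A B, posop A -> strict_posop B ->
              B <=op sigma A B -> B <=op A;
   (* 11 *) forall A B, posop A -> strict_posop B ->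
              sigma A B <=op B -> A <=op B;
   (* 12 *) ~ (forall x, 0 <= x -> f x = x);
   (* 13 *) ~ (forall E : set (measurableTypeR R), measurable E ->
                 mu E = \d_(1 : R) E)].
Proof.
have [s_conn s_id] := sigma_mean.
have [v v0] := kubo_ando_nontrivial KA.
have f_ge0 x : 0 <= x -> 0 <= f x by case: sigma_f => -[_ + _] _; exact.
have f1 : f 1 = 1.
  by apply: (scalop_inj v0); rewrite sigma_f.2// s_id//; exact: posop_id.
have s_hom a A : 0 <= a -> posop A -> sigma A (scaleop a A) = scaleop (f a) A.
  by apply: connection_homogeneous => //; exists v.
have f_id : (forall E : set (measurableTypeR R), measurable E ->
    mu E = \d_(1 : R) E) -> forall x, 0 <= x -> f x = x.
  move=> mu1 x x0; rewrite -[RHS]wharmonic1_right.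
  have i1 : 0 <= (1 : R) <= 1 by rewrite ler01 lexx.
  apply: (associated_dirac i1) => //.
  split=> [|y y0]; first exact: on_unit_interval_dirac.
  by rewrite f_mu.2//; apply: eq_measure_integral => E mE _; exact: mu1.
have trivial_f : right_trivial sigma -> forall x, 0 <= x -> f x = x.
  move=> triv x x0; apply: (scalop_inj v0); rewrite sigma_f.2//.
  by apply: triv; [exact: posop_id|exact: posop_scalop].
have f_trivial : (forall x, 0 <= x -> f x = x) -> right_trivial sigma.
  exact: representing_id_right_trivial.
have sI : strict_posop (idop : boundedOp H).
  exact: (strict_posop_scalop ltr01).
have I0 := sI.1.
have s2 : strict_posop (scalop (2 : R)%:C : boundedOp H).
  exact: strict_posop_scalop.
have h0 : (0 : R) < 2^-1 by lra.
have sh : strict_posop (scalop (2^-1 : R)%:C : boundedOp H).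
  exact: strict_posop_scalop.
have O0 : posop (scalop (0 : R)%:C : boundedOp H) by exact: posop_scalop.
have strict : ~ right_trivial sigma ->
  (forall A B, posop A -> strict_posop B -> B <=op sigma A B -> B <=op A) /\
  (forall A B, posop A -> strict_posop B -> sigma A B <=op B -> A <=op B).
  move=> ntriv; have [f_lt1 f_gt1] : (forall b, 0 < b < 1 -> b < f b) /\
      (forall b, 1 < b -> f b < b).
    by apply: (associated_strict f_mu f1) => mu1; exact/ntriv/f_trivial/f_id.
  split=> A B A0 sB; first exact: (connection_ge_right s_conn f_ge0 s_hom).
  exact: (connection_le_right s_conn s_hom).
have strict_eq : ~ right_trivial sigma ->
  forall A B, posop A -> strict_posop B -> sigma A B = B -> A = B.
  move=> /strict[s_ge s_le] A B A0 sB AB; apply: leop_antisym.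
    by apply: s_le => //; rewrite AB; exact: leop_refl.
  by apply: s_ge => //; rewrite AB; exact: leop_refl.
have not2 : ~ scalop (2 : R)%:C <=op (idop : boundedOp H).
  by move/(@scalop_le _ _ _ 2 1 v0) => ?; lra.
have not0 : ~ (idop : boundedOp H) <=op scalop (0 : R)%:C.
  by move/(@scalop_le _ _ _ 1 0 v0) => ?; lra.
have eq_leop (A B : boundedOp H) : A = B -> A <=op B.
  by move=> ->; exact: leop_refl.
tfae.
- move=> P triv; apply/not2/eq_leop/P => //; exact: triv s2.1 I0.
- by move=> ntriv A A0; exact: strict_eq.
- move=> P A sA IA; apply/esym/strict_eq => //.
  by move=> triv; apply/not0/eq_leop/esym/P => //; exact: triv.
- move=> P; apply: strict_eq => triv.
  by apply/not2/eq_leop/P => //; exact: triv I0 s2.1.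
- move=> P A A0; apply: (strict _).1 => // triv.
  by apply/not0/eq_leop/esym/P => //; exact: triv.
- move=> P A A0; apply: (strict _).2 => // triv.
  by apply/not0/P => //; exact/eq_leop/esym/triv.
- move=> P A sA; apply: (strict _).1 => // triv.
  by apply/not2/P; [exact: s2.1|exact/eq_leop/triv/I0/s2.1].
- move=> P A sA; apply: (strict _).2 => // triv.
  by apply/not2/P => //; exact/eq_leop/esym/triv/s2.1/I0.
- move=> P; apply: (strict _).1 => triv.
  have /(@scalop_le _ _ _ 1 2^-1 v0) :
      (idop : boundedOp H) <=op scalop (2^-1 : R)%:C.
    by apply: P => //; exact/eq_leop/triv/sh.1/I0.
  by move=> ?; lra.
- move=> P; apply: (strict _).2 => triv.
  by apply/not0/P => //; exact/eq_leop/esym/triv.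
- move=> P /f_trivial triv; apply/not2/P => //; first exact: s2.1.
  exact/eq_leop/triv/I0/s2.1.
- by move=> P /f_id.
- move=> P; have ntriv : ~ right_trivial sigma.
    move=> /trivial_f f_x; apply: P; have two0 : (0 : R) < 2 by lra.
    by apply: (associated_fixpoint_dirac f_mu f1 two0); [lra|exact/f_x/ltW].
  by move=> A B [A0 _]; exact: strict_eq.
Qed.
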